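(* For every $r, D \in \mathbb{N}$ there exists a constant $C = C(r, D) > 0$ such that the following holds: for every $n \in \mathbb{N}$ there exists an $r$-graph $\Gamma$ with $$e(\Gamma) \le C\, n^{r - r/D} \log^{r/D}(n)$$ which is $\mathcal{H}^{(r)}(D, n)$-universal.
   Context: An $r$-graph ($r$-uniform hypergraph) is a hypergraph in which every hyperedge is an $r$-element subset of the vertex set; $e(\Gamma)$ is the number of hyperedges of $\Gamma$. The degree of a vertex is the number of hyperedges containing it. $\mathcal{H}^{(r)}(D,n)$ denotes the family of all $r$-graphs with $n$ vertices and maximum degree at most $D$. A hypergraph $\Gamma$ is $\mathcal{H}$-universal, for a family $\mathcal{H}$ of hypergraphs, if it contains every $H \in \mathcal{H}$ as a (not necessarily induced) subgraph, i.e. there is an injective map $V(H) \to V(\Gamma)$ sending every hyperedge of $H$ to a hyperedge of $\Gamma$. The number of vertices of $\Gamma$ is not restricted. $\log^{s}(n)$ means $(\log n)^{s}$.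
   Formalization: The formal theorem assumes r ≥ 2 and D ≥ 2; the claim fails for r = 1 (n singleton hyperedges force e(Γ) ≥ n) and for D = 1 (a matching forces e(Γ) ≥ ⌊n/r⌋, but the bound is C log^r n). *)

(* Defs.v *)
From HB Require Import structures.
From mathcomp Require Import all_boot all_order all_algebra.
From mathcomp Require Import reals exp.

Set Implicit Arguments.
Unset Strict Implicit.
Unset Printing Implicit Defensive.

Record hypergraph (r : nat) := Hypergraph {
  vertex :> finType;
  hedges : {set {set vertex}};
  hedges_uniform : forall e : {set vertex}, e \in hedges -> #|e| = r
}.

Definition degree (r : nat) (H : hypergraph r) (v : H) : nat :=
  #|[set e in hedges H | v \in e]|.

Definition max_degree (r : nat) (H : hypergraph r) : nat :=
  \max_(v : H) degree v.

Definition bounded_degree_family (r D n : nat) (H : hypergraph r) : Prop :=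
  #|H| = n /\ max_degree H <= D.

Definition contains (r : nat) (G H : hypergraph r) : Prop :=
  exists f : H -> G,
    injective f /\
    forall e : {set H}, e \in hedges H -> f @: e \in hedges G.

Definition universal (r : nat) (F : hypergraph r -> Prop) (G : hypergraph r) : Prop :=
  forall H : hypergraph r, F H -> contains G H.

(* Main.v *)
From HB Require Import structures.
Require Import Defs.
From mathcomp Require Import all_boot all_order all_algebra.
From mathcomp Require Import perm ring lra.
From mathcomp Require Import reals sequences exp.
Import Order.TTheory GRing.Theory Num.Theory.

(** Let D be the degree bound, m = |A|^k the number of words of length k over
    an alphabet A of bounded size, with k such that m^D is about n / ln n, and
    let K be a multiple of ln n.  A vertex of the host hypergraph is a position
    (one word for each of D colours) together with one of K copies.  A
    hyperedge carries r constraints, one for each of its vertices: the word of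
    that vertex in some colour is one of the unconstrained words of the
    hyperedge, kept or shifted by one letter to the left or to the right.  So
    r of the r D words are determined by the others up to a bounded number of
    choices, and there are O((m^(D-1) K)^r) hyperedges ([card_host_edges]),
    which is the required bound ([edge_bound]).

    To embed H, give each incidence (v, e) one of D colours so that the
    hyperedges at a vertex get distinct colours and no hyperedge is
    monochromatic ([incidence_colouring]).  For a vertex v and a colour i let
    [walk i v] be a vertex of the hyperedge that v sees in colour i, chosen
    among those that see this hyperedge in another colour.  If the words
    f i v and f i (walk i v) always agree up to a shift, then the r incidences
    of a hyperedge supply its r constraints ([embedding]).  What remains is
    to choose the words so that at most K vertices of H share a position;
    copies then separate them.

    If walk i were the parent map of a forest, one could give each vertex v a
    random letter and let the word of v list the letters of v and of its k - 1
    nearest ancestors.  In general walk i has cycles, so each cycle is first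
    folded flat onto a path, which identifies at most two vertices at a time
    ([fold], [fold_adjacent]).  The letters are chosen by the method of
    conditional expectations: from the roots downwards, so that a potential
    bounding the expected value of the sum of exp(|fibre| / 64) never
    increases ([forest_words]).  Hence, whenever the vertices are split into
    classes of size at most N, the words of one colour can be chosen so that
    every word occurs at most O(ln n) + 2 N / m times in every class
    ([balanced_words]).  Refining the classes colour by colour, from N = n,
    gives fibres of size O(ln n + n / m^D) = O(ln n) ([balanced_positions]). *)

Set Implicit Arguments.
Unset Strict Implicit.
Unset Printing Implicit Defensive.

(** * Incidence colourings without monochromatic hyperedges *)

Section Colouring.
Variables (V : finType) (D : nat) (E : {set {set V}}).
Implicit Types (c : V -> {set V} -> 'I_D) (e : {set V}) (v : V).

Definition proper_colouring c :=
  forall v e e', e \in E -> e' \in E -> v \in e -> v \in e' ->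
    c v e = c v e' -> e = e'.

Definition monochromatic c e := [forall u in e, forall v in e, c u e == c v e].

Definition swap_at v (a b : 'I_D) c u e :=
  if u == v then tperm a b (c u e) else c u e.

Lemma swap_at_proper v a b c : proper_colouring c -> proper_colouring (swap_at v a b c).
Proof.
move=> cP u e e' eE e'E ue ue'; rewrite /swap_at; case: eqP => _; last exact: cP.
by move=> /perm_inj; apply: cP.
Qed.

Lemma monochromaticP c e v : v \in e -> monochromatic c e -> forall u, u \in e -> c u e = c v e.
Proof. by move=> ve /forall_inP me u /me /forall_inP/(_ v ve)/eqP. Qed.

Lemma monochromatic_swap_at v a b c e : (v \in e -> c v e != a /\ c v e != b) ->
  monochromatic (swap_at v a b c) e = monochromatic c e.
Proof.
move=> h; apply: eq_forallb => u; apply: implyb_id2l => ue.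
apply: eq_forallb => z; apply: implyb_id2l => ze.
have sw x : x \in e -> swap_at v a b c x e = c x e.
  rewrite /swap_at; case: eqP => // -> /h [h1 h2].
  by rewrite tpermD // eq_sym.
by rewrite !sw.
Qed.

(** A Kempe chain.  Exchanging the colours [a] and [b] at a vertex v of the
    monochromatic hyperedge [e] repairs [e]; the only other hyperedge affected
    is the one seen by v in colour [b], and if it becomes monochromatic the
    repair continues there.  The set [S] of hyperedges not yet repaired
    shrinks, so the chain stops.  Repaired hyperedges stay untouched because
    of the last hypothesis: only the vertex [v0] through which the chain
    entered [e] may lead from [S] back to a repaired hyperedge. *)
Lemma kempe_walk (a b : 'I_D) (s : nat) : a != b ->
  (forall e, e \in E -> 1 < #|e|) ->
  forall (S : {set {set V}}) c e v0, #|S| <= s -> S \subset E -> proper_colouring c ->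
  e \in S -> v0 \in e -> (forall u, u \in e -> c u e = a) ->
  (forall u e1 e2, u != v0 -> e2 \in E -> e2 \notin S -> u \in e2 -> c u e2 = b ->
     e1 \in S -> u \in e1 -> c u e1 != a) ->
  exists2 c', proper_colouring c' &
    forall e', e' \in E -> monochromatic c' e' -> monochromatic c e' && (e' != e).
Proof.
move=> ab E2; elim: s => [|s IH] S c e v0.
  by rewrite leqn0 cards_eq0 => /eqP -> _ _; rewrite inE.
move=> Ss SE cP eS v0e ea inv.
have eE := subsetP SE _ eS.
(* leave [e] through a vertex other than the one of entry *)
have [v ve vv0] : exists2 v, v \in e & v != v0.
  have : 0 < #|e :\ v0| by have := E2 _ eE; rewrite (cardsD1 v0) v0e.
  by move=> /card_gt0P [v]; rewrite !inE => /andP[]; exists v.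
pose c1 := swap_at v a b c.
have c1P : proper_colouring c1 by apply: swap_at_proper.
have c1N u f : u != v -> c1 u f = c u f by rewrite /c1 /swap_at => /negPf ->.
have c1V f : c1 v f = tperm a b (c v f) by rewrite /c1 /swap_at eqxx.
have eN : ~~ monochromatic c1 e.
  apply/negP => /(monochromaticP v0e)/(_ v ve); rewrite c1V c1N 1?eq_sym //.
  by rewrite !ea // tpermL => /eqP; rewrite eq_sym (negPf ab).
have other e' : e' \in E -> (v \in e' -> c v e' != b) ->
    monochromatic c1 e' -> monochromatic c e' && (e' != e).
  move=> e'E hb me'; have e'e : e' != e by apply: contraNneq eN => <-.
  rewrite e'e andbT -(@monochromatic_swap_at v a b) // => ve'; split; last exact: hb.
  by apply: contra_neq e'e => cva; apply: (cP v) => //; rewrite cva ea.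
have [/existsP [e' /and3P [e'E ve' /eqP cb]]|none] :=
    boolP [exists e', [&& e' \in E, v \in e' & c v e' == b]]; last first.
  exists c1 => // e' e'E; apply: other => // ve'.
  by apply: contra none => cb; apply/existsP; exists e'; rewrite e'E ve'.
have e'S : e' \in S.
  by apply: contraTT isT => e'S; have := inv v e e' vv0 e'E e'S ve' cb eS ve; rewrite ea // eqxx.
have e'e : e' != e.
  by apply: contra_neq ab => e'e; rewrite -cb -(ea v ve) e'e.
have [me'|nme'] := boolP (monochromatic c1 e'); last first.
  exists c1 => // f fE mf; apply: other => // vf.
  apply: contraNneq nme' => cf; suff -> : e' = f by [].
  by apply: (cP v) => //; rewrite cf.
have [|||||c' c'P h] := IH (S :\ e) c1 e' v _ _ c1P _ ve'.
- by rewrite -ltnS (leq_trans _ Ss) // [X in _ < X](cardsD1 e) eS.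
- by apply: subset_trans SE; apply: subD1set.
- by rewrite !inE e'e.
- by move=> u /(monochromaticP ve' me') ->; rewrite c1V cb tpermR.
- move=> u f1 f2 uv f2E; rewrite !inE negb_and negbK => f2S uf2.
  rewrite !c1N // => cu /andP [f1e f1S] uf1.
  have f2e : f2 != e.
    by apply: contra_neq ab => f2e; rewrite -cu f2e ea // -f2e.
  rewrite (negPf f2e) /= in f2S.
  have [uv0|] := eqVneq u v0; last by move=> uv0; apply: (inv _ _ f2).
  apply: contra_neq f1e => cf1; apply: (cP u) => //; first exact: (subsetP SE).
    by rewrite uv0.
  by rewrite cf1 ea // uv0.
exists c' => // f fE /(h f fE) /andP [mf fe'].
apply: other => // vf; apply: contra_neq fe' => cf.
by apply: (cP v) => //; rewrite cf.
Qed.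

(** Start from any numbering of the hyperedges at each vertex and remove the
    monochromatic hyperedges one at a time by Kempe chains. *)
Lemma incidence_colouring : 1 < D -> (forall e, e \in E -> 1 < #|e|) ->
  (forall v, #|[set e in E | v \in e]| <= D) ->
  exists2 c, proper_colouring c & forall e, e \in E -> ~~ monochromatic c e.
Proof.
move=> D1 E2 dE; have D0 := ltnW D1.
have step N c : proper_colouring c -> #|[set e in E | monochromatic c e]| <= N ->
    exists2 c', proper_colouring c' & forall e, e \in E -> ~~ monochromatic c' e.
  elim: N c => [|N IH] c cP.
    rewrite leqn0 cards_eq0 => /eqP m0; exists c => // e eE.
    by apply/negP => me; have := in_set0 e; rewrite -m0 inE eE me.
  have [/existsP [e]|none] := boolP [exists e, e \in [set e in E | monochromatic c e]]; last first.
    move=> _; apply: (IH c cP); rewrite (_ : [set e in E | monochromatic c e] = set0) ?cards0 //.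
    apply/setP => e; rewrite in_set0; apply: contraNF none => he; by apply/existsP; exists e.
  rewrite inE => /andP [eE me] cN.
  have /card_gt0P [v ve] : 0 < #|e| by apply: ltnW; apply: E2.
  have [b ab] : exists b : 'I_D, c v e != b.
    have [c0|c0] := eqVneq (val (c v e)) 0; last by exists (Ordinal D0).
    by exists (Ordinal D1); rewrite -val_eqE /= c0.
  have [|||c' c'P h] :=
    @kempe_walk (c v e) b #|E| ab E2 E c e v _ _ cP eE ve (monochromaticP ve me) => //.
    by move=> u e1 e2 _ -> .
  apply: (IH c' c'P); rewrite -ltnS (leq_trans _ cN) // [X in _ < X](cardsD1 e).
  rewrite inE eE me ltnS; apply: subset_leq_card; apply/subsetP => f.
  by rewrite !inE => /andP [fE /(h f fE) /andP [-> ->]]; rewrite fE.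
pose c0 v e : 'I_D := insubd (Ordinal D0) (index e (enum [set e in E | v \in e])).
apply: (step _ c0) (leqnn _).
move=> v e e' eE e'E ve ve' /(congr1 val); rewrite /c0.
have lt f : f \in E -> v \in f -> index f (enum [set e in E | v \in e]) < D.
  by move=> fE vf; rewrite (leq_trans _ (dE v)) // cardE index_mem mem_enum inE fE.
rewrite /= !val_insubd !lt // => /(index_inj e).
by apply; rewrite mem_enum inE ?eE ?e'E.
Qed.
End Colouring.

(** * The walk of a colour *)

Section Walk.
Variables (D : nat) (V : finType) (E : {set {set V}}) (col : V -> {set V} -> 'I_D).

(** The default [v] is taken when no hyperedge has colour [i] at [v], or when
    this hyperedge is monochromatic. *)
Definition walk (i : 'I_D) (v : V) : V :=
  if [pick e in E | (v \in e) && (col v e == i)] is Some e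
  then odflt v [pick u in e | col u e != i] else v.

Lemma walkP e v : proper_colouring E col -> ~~ monochromatic col e -> e \in E -> v \in e ->
  walk (col v e) v \in e /\ col (walk (col v e) v) e != col v e.
Proof.
move=> cP ne eE ve; rewrite /walk; case: pickP => [e'|/(_ e)]; last by rewrite eE ve eqxx.
move=> /and3P [e'E ve' /eqP ce']; have -> : e' = e by apply: (cP v).
case: pickP => [u /andP[]//|none] /=; case/negP: ne.
have same u : u \in e -> col u e = col v e.
  by move=> ue; have := none u; rewrite ue => /negbFE /eqP.
by apply/forall_inP => u ue; apply/forall_inP => z ze; rewrite !same.
Qed.

Lemma walk_preimages r d i u : (forall e, e \in E -> #|e| = r) ->
  (forall v, #|[set e in E | v \in e]| <= d)%N ->
  (#|[set v | walk i v == u]| <= (d * r).+1)%N.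
Proof.
move=> Er dE; apply: leq_trans (_ : #|u |: \bigcup_(e in [set e in E | u \in e]) e| <= _)%N.
  apply/subset_leq_card/subsetP => v; rewrite !inE /walk.
  case: pickP => [e /and3P [eE ve _]|_]; last by move=> /eqP ->; rewrite eqxx.
  case: pickP => [z /andP[ze _]|_] /= /eqP <-; last by rewrite eqxx.
  by apply/orP; right; apply/bigcupP; exists e; rewrite // inE eE.
apply: leq_trans (leq_card_setU _ _) _; rewrite cards1 add1n ltnS.
apply: leq_trans (_ : \sum_(e in [set e in E | u \in e]) r <= _)%N.
  apply: (@leq_trans (\sum_(e in [set e in E | u \in e]) #|e|)).
    elim/big_rec2: _ => [|e s B _ h]; first by rewrite cards0.
    by rewrite (leq_trans (leq_card_setU _ _)) // leq_add.
  by apply: leq_sum => e; rewrite inE => /andP [/Er ->].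
by rewrite sum_nat_const leq_mul2r dE orbT.
Qed.
End Walk.

(** * Folding a functional graph onto a forest *)

Section Folding.
Variables (V : finType) (g : V -> V).

Definition cyclic v := fcycle g (orbit g v).

(** A base point shared by all elements of a cycle: [pick] depends only on the
    extension of the predicate. *)
Definition cycle_root v :=
  odflt v [pick u | fconnect g v u && fconnect g u v].

Definition cycle_pos v := findex g (cycle_root v) v.

(** With the base point c_0, a cycle c_0, ..., c_(l-1) is folded at c_0 and at
    the antipodal point: c_j goes to c_(min (j, l - j)). *)
Definition fold v :=
  if cyclic v then
    let r := cycle_root v in
    iter (minn (cycle_pos v) (order g r - cycle_pos v)) g r
  else v.

(** On a cycle the parent of c_(j+1) is c_j and c_0 is a root, so that the
    closing step from c_(l-1) to c_0 disappears; off the cycles the parent is the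
    folded image under [g]. *)
Definition fold_parent v : option V :=
  if cyclic v then
    if cycle_pos v is j.+1 then Some (iter j g (cycle_root v)) else None
  else Some (fold (g v)).

(** Witnesses that the parent map has no cycle.  Off the cycles of [g] the
    length of the orbit drops by one at each step, and the shift by |V| puts
    these vertices above the cycles. *)
Definition fold_rank v :=
  if cyclic v then cycle_pos v else #|V| + order g v.

Lemma cyclic_sym v u : cyclic v -> fconnect g v u -> fconnect g u v.
Proof.
move=> cv vu; have vo : u \in orbit g v by rewrite -fconnect_orbit.
by rewrite (fconnect_cycle cv).
Qed.

Lemma cyclic_connect v u : cyclic v -> fconnect g v u -> cyclic u.
Proof.
move=> cv vu; rewrite /cyclic -fconnect_f.
have gu := connect_trans vu (fconnect1 g u).
exact: connect_trans (cyclic_sym cv gu) vu.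
Qed.

Lemma cycle_rootP v : fconnect g v (cycle_root v) /\ fconnect g (cycle_root v) v.
Proof.
rewrite /cycle_root; case: pickP => [u /andP[]|] //= _.
Qed.

Lemma cycle_root_eq v u : cyclic v -> fconnect g v u -> cycle_root u = cycle_root v.
Proof.
move=> cv vu; have uv := cyclic_sym cv vu.
rewrite /cycle_root (@eq_pick _ _ (fun w => fconnect g v w && fconnect g w v)).
  by case: pickP => //= /(_ v); rewrite connect0.
by move=> w; congr (_ && _); apply/idP/idP;
  [exact: connect_trans vu | exact: connect_trans uv
  | move=> h; exact: connect_trans h uv | move=> h; exact: connect_trans h vu].
Qed.

Lemma iter_cycle_pos v : iter (cycle_pos v) g (cycle_root v) = v.
Proof. by apply: iter_findex; have [] := cycle_rootP v. Qed.

Lemma cycle_pos_lt v : cycle_pos v < order g (cycle_root v).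
Proof. by apply: findex_max; have [] := cycle_rootP v. Qed.

Lemma cyclic_root v : cyclic v -> cyclic (cycle_root v).
Proof. by move=> cv; apply: cyclic_connect cv _; have [] := cycle_rootP v. Qed.

Lemma cycle_iter v j : cyclic v -> j < order g (cycle_root v) ->
  let u := iter j g (cycle_root v) in
  [/\ cyclic u, cycle_root u = cycle_root v & cycle_pos u = j].
Proof.
move=> cv jlt u; have [vr rv] := cycle_rootP v.
have vu : fconnect g v u by rewrite (connect_trans vr) // fconnect_iter.
split; first exact: cyclic_connect vu.
  exact: cycle_root_eq.
by rewrite /cycle_pos (cycle_root_eq cv vu) findex_iter.
Qed.

Lemma fold_cyclic v : cyclic v ->
  [/\ cyclic (fold v), cycle_root (fold v) = cycle_root v &
      cycle_pos (fold v) = minn (cycle_pos v) (order g (cycle_root v) - cycle_pos v)].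
Proof.
move=> cv; rewrite /fold cv; apply: cycle_iter => //.
by rewrite gtn_min cycle_pos_lt.
Qed.

Lemma fold_ncyclic v : ~~ cyclic v -> fold v = v.
Proof. by rewrite /fold => /negPf ->. Qed.

Lemma cyclic_fold v : cyclic (fold v) = cyclic v.
Proof.
have [/fold_cyclic[]//|nv] := boolP (cyclic v).
by rewrite fold_ncyclic // (negPf nv).
Qed.

(** Besides itself, c_j is the image of at most c_(l-j). *)
Lemma fold_fibre y : #|[set v | fold v == y]| <= 2.
Proof.
have [cy|ncy] := boolP (cyclic y); last first.
  apply: leq_trans (_ : #|[set y]| <= _); last by rewrite cards1.
  apply/subset_leq_card/subsetP => v; rewrite !inE => /eqP fv.
  by rewrite -fv fold_ncyclic // -cyclic_fold fv.
pose r := cycle_root y.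
apply: leq_trans (_ : #|[set y; iter (order g r - cycle_pos y) g r]| <= _); last first.
  by rewrite cards2; case: (_ != _).
apply/subset_leq_card/subsetP => v; rewrite !inE => /eqP fv.
have cv : cyclic v by rewrite -cyclic_fold fv.
have [_] := fold_cyclic cv; rewrite fv => rE pE.
rewrite -{1 2}(iter_cycle_pos v) -{1}(iter_cycle_pos y) /r rE pE.
rewrite /minn; case: ltnP => _; first by rewrite eqxx.
by rewrite subKn ?eqxx ?orbT // ltnW // cycle_pos_lt.
Qed.

Lemma fold_parent_rank v y : fold_parent v = Some y -> fold_rank y < fold_rank v.
Proof.
rewrite /fold_parent /fold_rank; have [cv|ncv] := boolP (cyclic v).
  case E: (cycle_pos v) => [//|j] [<-].
  have [|cu _ ->] := @cycle_iter v j cv; last by rewrite cu.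
  by rewrite (leq_trans _ (cycle_pos_lt v)) // E.
case=> <-; rewrite cyclic_fold; case: ifP => [cg|/negbT ncg].
  apply: leq_trans (cycle_pos_lt _) (leq_trans _ (leq_addr _ _)).
  exact: max_card.
rewrite fold_ncyclic // ltn_add2l; move: ncv; rewrite /cyclic.
by case: orderPcycle => // _ ->.
Qed.

(** Along a cycle min (j, l - j) changes by at most one from j to j + 1, and
    also from l - 1 to 0; it stays constant exactly at the fold of an odd
    cycle. *)
Lemma fold_adjacent v :
  [\/ fold v = fold (g v), fold_parent (fold v) = Some (fold (g v)) |
      fold_parent (fold (g v)) = Some (fold v)].
Proof.
have [cv|ncv] := boolP (cyclic v); last first.
  by constructor 2; rewrite fold_ncyclic // /fold_parent (negPf ncv).
have vg := fconnect1 g v.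
have cg := cyclic_connect cv vg.
have rg := cycle_root_eq cv vg.
have par u w j : cyclic u -> cycle_root u = cycle_root v -> cycle_pos u = j.+1 ->
    cyclic w -> cycle_root w = cycle_root v -> cycle_pos w = j -> fold_parent u = Some w.
  move=> cu ru pu cw rw pw; rewrite /fold_parent cu pu ru.
  by rewrite -(iter_cycle_pos w) rw pw.
have same u w : cycle_root u = cycle_root v -> cycle_root w = cycle_root v ->
    cycle_pos u = cycle_pos w -> u = w.
  by move=> ru rw pu; rewrite -(iter_cycle_pos w) -(iter_cycle_pos u) ru rw pu.
have [c1 r1 p1] := fold_cyclic cv; have [c2 r2 p2] := fold_cyclic cg.
rewrite rg in r2 p2; have lt := cycle_pos_lt v.
set l := order g _ in p1 p2 lt.
(* the step that closes the cycle is treated first *)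
have [lt1|] := ltnP (cycle_pos v).+1 l; last first.
  move=> le; have El : (cycle_pos v).+1 = l by apply/eqP; rewrite eqn_leq lt.
  have pg : cycle_pos (g v) = 0.
    apply/eqP; rewrite /cycle_pos findex_eq0 rg -[X in g X]iter_cycle_pos -iterS El.
    by apply/eqP/esym/(orbitPcycle 0 4); apply: cyclic_root.
  rewrite pg min0n in p2; rewrite -El subSnn in p1.
  case E: (cycle_pos v) p1 => [|j] p1.
    by constructor 1; apply: same => //; rewrite p1 p2.
  by constructor 2; apply: (par _ _ 0) => //; rewrite p1 /minn; case: j {p1 E}.
have pg : cycle_pos (g v) = (cycle_pos v).+1.
  rewrite /cycle_pos rg -[X in g X](iter_cycle_pos v) -iterS findex_iter //.
rewrite pg subnS in p2; move: p1 p2 lt1; move: (cycle_pos v) => j p1 p2 lt1.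
have : l - j = (l - j.+1).+1 by rewrite subnSK // ltnW.
have : 0 < l - j.+1 by rewrite subn_gt0.
rewrite -subnS in p2.
move: (l - j.+1) p2 => i p2 i0 E; rewrite E in p1.
have [ij|ij|ij] := ltngtP i j.
- constructor 2; apply: (par _ _ i) => //.
    by rewrite p1; apply/minn_idPr.
  by rewrite p2; apply/minn_idPr; rewrite ltnW // ltnW.
- constructor 3; apply: (par _ _ j) => //; last first.
    by rewrite p1; apply/minn_idPl; rewrite ltnW // ltnW.
  by rewrite p2; apply/minn_idPl.
- constructor 1; apply: same => //; rewrite p1 p2 ij.
  exact: minnC.
Qed.

Lemma fold_children (d : nat) y : (forall u, #|[set v | g v == u]| <= d) ->
  #|[set v | fold_parent v == Some y]| <= d.*2.+1.
Proof.
move=> gd; apply: leq_trans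
  (_ : #|[set g y] :|: \bigcup_(u in [set u | fold u == y]) [set v | g v == u]| <= _).
  apply/subset_leq_card/subsetP => v; rewrite !inE /fold_parent.
  have [cv|ncv] := boolP (cyclic v) => /eqP.
    case E: (cycle_pos v) => [//|j] [<-].
    by rewrite -iterS -E iter_cycle_pos eqxx.
  case=> fy; apply/orP; right; apply/bigcupP; exists (g v); rewrite inE ?fy //.
rewrite (leq_trans (leq_card_setU _ _)) // cards1 add1n ltnS.
apply: leq_trans (_ : \sum_(u in [set u | fold u == y]) d <= _).
  elim/big_rec2: _ => [|u s A _ h]; first by rewrite cards0.
  by rewrite (leq_trans (leq_card_setU _ _)) // leq_add.
by rewrite sum_nat_const -mul2n leq_mul // fold_fibre.
Qed.
End Folding.

(** * Words, shifts and overlaps *)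

Section Words.
Variables (A : finType) (k : nat).
Implicit Types (a : A) (w x : k.-tuple A).

Definition push a w : k.-tuple A := [tuple of belast a w].

(** The part of [x] that remains after its first [d] letters is a prefix of
    [w]: exactly then can [d] pushes turn [w] into [x]. *)
Definition overlap d w x := take (k - d) w == drop d x.

Lemma overlap0 w x : overlap 0 w x = (w == x).
Proof. by rewrite /overlap subn0 drop0 take_oversize ?size_tuple. Qed.

Lemma overlap_full w x : overlap k w x.
Proof. by rewrite /overlap subnn take0 drop_oversize ?size_tuple. Qed.

Lemma belast_take (a : A) s : belast a s = take (size s) (a :: s).
Proof. by elim: s a => //= b s IH a; rewrite IH. Qed.

Lemma overlap_push d a w x : d < k ->
  overlap d (push a w) x -> overlap d.+1 w x /\ a = nth a x d.
Proof.
move=> dk; rewrite /overlap /push /= belast_take size_tuple take_takel ?leq_subr //.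
rewrite -subnSK //= (drop_nth a) ?size_tuple //.
by move=> /eqP [<- ->].
Qed.

(** At most one letter can be pushed to keep an overlap, which is the source
    of a factor 1 / |A| for each generation. *)
Lemma count_overlap_push d w x : d < k ->
  #|[set a | overlap d (push a w) x]| <= overlap d.+1 w x.
Proof.
move=> dk; have [|no] := boolP (overlap d.+1 w x).
  move=> _; apply/card_le1_eqP => a b; rewrite !inE.
  move=> /(overlap_push dk) [_ ->] /(overlap_push dk) [_ ->].
  by apply: set_nth_default; rewrite size_tuple.
rewrite leqn0 cards_eq0; apply/eqP/setP => a; rewrite !inE.
by apply: contraNF no => /(overlap_push dk) [].
Qed.

Lemma count_overlap d x : d <= k -> #|[set w | overlap d w x]| <= #|A| ^ d.
Proof.
move=> dk.
pose f w := [ffun j : 'I_d => tnth w (cast_ord (subnK dk) (rshift (k - d) j))].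
rewrite -[d in _ ^ d]card_ord -card_ffun -cardsT -(@card_in_imset _ _ f).
  by apply: subset_leq_card; apply: subsetT.
move=> v w; rewrite !inE => /eqP ov /eqP ow fvw.
apply: eq_from_tnth => i; have [lt|ge] := ltnP i (k - d).
  have a : A := tnth v i.
  rewrite !(tnth_nth a) -(nth_take _ lt) -[RHS](nth_take _ lt).
  by rewrite ov ow.
have jd : i - (k - d) < d by rewrite ltn_subLR // subnK.
move/ffunP/(_ (Ordinal jd)): fvw; rewrite !ffunE.
suff -> : cast_ord (subnK dk) (rshift (k - d) (Ordinal jd)) = i by [].
by apply: val_inj; rewrite /= subnKC.
Qed.

End Words.

Section Decode.
Variables (A : finType) (k : nat).
Implicit Types (a : A) (w x : k.-tuple A).

Definition pull a w : k.-tuple A := [tuple of behead (rcons w a)].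

Definition decode (c : option (bool * A)) w : k.-tuple A :=
  match c with
  | None => w
  | Some (true, a) => push a w
  | Some (false, a) => pull a w
  end.

(** Shifts can be undone, so a parent also arises from its child by one shift. *)
Lemma push_pull a w : exists b, w = pull b (push a w).
Proof. by exists (last a w); apply: val_inj; rewrite /= -lastI. Qed.
End Decode.

(** * The host hypergraph *)

Section Host.
Variables (r D' K k : nat) (A : finType).
Local Notation D := D'.+1.
Local Notation word := (k.-tuple A).

Definition host_vertex : finType := ({ffun 'I_D -> word} * 'I_K)%type.

(** The data of one vertex of a host hyperedge: the words in all colours other
    than [slot] are [free]; the word in colour [slot] is obtained by [step] from
    the free word with index [target]. *)
Record vertex_code := VertexCode {
  slot : 'I_D;
  target : 'I_r * 'I_D';
  step : option (bool * A);
  free : {ffun 'I_D' -> word};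
  copy : 'I_K }.

Definition vertex_code_tuple c := (slot c, target c, step c, free c, copy c).
Definition tuple_vertex_code t :=
  let: (i, t', s, f, h) := t in VertexCode i t' s f h.
Lemma vertex_code_tupleK : cancel vertex_code_tuple tuple_vertex_code.
Proof. by case. Qed.
HB.instance Definition _ := Finite.copy vertex_code (can_type vertex_code_tupleK).

Definition decode_vertex (c : {ffun 'I_r -> vertex_code}) (s : 'I_r) : host_vertex :=
  ([ffun i => if unlift (slot (c s)) i is Some j then free (c s) j
              else decode (step (c s)) (free (c (target (c s)).1) (target (c s)).2)],
   copy (c s)).

Definition host_edges : {set {set host_vertex}} :=
  [set e in [set [set decode_vertex c s | s : 'I_r] | c : {ffun 'I_r -> vertex_code}]
     | #|e| == r].

Lemma host_edges_uniform (e : {set host_vertex}) : e \in host_edges -> #|e| = r.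
Proof. by rewrite inE => /andP [_ /eqP]. Qed.

Definition host : hypergraph r := Hypergraph host_edges_uniform.

Lemma card_vertex_code :
  #|{: vertex_code}| = (D * (r * D') * (2 * #|A|).+1 * (#|A| ^ k) ^ D' * K)%N.
Proof.
have /bij_eq_card -> : bijective vertex_code_tuple.
  by exists tuple_vertex_code; [exact: vertex_code_tupleK | case=> [[[[]]]]].
by rewrite !card_prod card_option card_prod card_bool card_ffun card_tuple !card_ord.
Qed.

Lemma card_host_edges :
  (#|hedges host| <= (D * (r * D') * (2 * #|A|).+1 * (#|A| ^ k) ^ D' * K) ^ r)%N.
Proof.
rewrite -card_vertex_code -[X in (_ <= _ ^ X)%N]card_ord -card_ffun.
apply: leq_trans (leq_imset_card (fun c => [set decode_vertex c s | s : 'I_r]) _).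
by apply: subset_leq_card; apply/subsetP => e; rewrite inE => /andP [].
Qed.
End Host.

Section Embedding.
Variables (r D' K k : nat) (A : finType) (H : hypergraph r).
Local Notation D := D'.+1.
Variables (col : H -> {set H} -> 'I_D) (g : 'I_D -> H -> H) (f : 'I_D -> H -> k.-tuple A).
Hypothesis gP : forall e v, e \in hedges H -> v \in e ->
  g (col v e) v \in e /\ col (g (col v e) v) e != col v e.
Hypothesis fP : forall i v, exists c, f i v = decode c (f i (g i v)).

Let pos v := [ffun i => f i v].
Hypothesis posP : forall x, (#|[set v | pos v == x]| <= K)%N.

(** In a hyperedge [e], the vertex [v] has slot [col v e] and its target is the
    word of [g (col v e) v] in this colour, which is free since that vertex
    sees [e] in another colour. *)
Lemma embedding : contains (host r D' K k A) H.
Proof.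
have idx v : (index v (enum [set u | pos u == pos v]) < K)%N.
  by rewrite (leq_trans _ (posP (pos v))) // cardE index_mem mem_enum inE.
pose F v : host_vertex D' K k A := (pos v, Ordinal (idx v)).
have F_inj : injective F.
  move=> u v [puv]; rewrite puv => /(index_inj u); apply; by rewrite mem_enum inE ?puv.
exists F; split=> // e eE; have er := hedges_uniform eE.
pose en (s : 'I_r) : H := enum_val (cast_ord (esym er) s).
have en_e s : en s \in e by apply: enum_valP.
have en_surj v : v \in e -> exists s, en s = v.
  move=> ve; exists (cast_ord er (enum_rank_in ve v)).
  by rewrite /en cast_ordK enum_rankK_in.
have code s : exists c : vertex_code r D' K k A,
   [/\ slot c = col (en s) e, copy c = (F (en s)).2,
       free c = [ffun j => f (lift (col (en s) e) j) (en s)],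
       lift (col (en (target c).1) e) (target c).2 = col (en s) e &
       f (col (en s) e) (en s) = decode (step c) (f (col (en s) e) (en (target c).1))].
  have [ge gcol] := gP eE (en_e s); have [t ht] := en_surj _ ge.
  have [c hc] := fP (col (en s) e) (en s).
  have := gcol; rewrite -ht => gcol'.
  have [j hj _] := unlift_some gcol'.
  exists (VertexCode (col (en s) e) (t, j) c
    [ffun j => f (lift (col (en s) e) j) (en s)] (F (en s)).2).
  by split => //=; rewrite ht.
have [c hc] := fin_all_exists code.
have dec s : decode_vertex [ffun s => c s] s = F (en s).
  rewrite /decode_vertex !ffunE /F; have [h1 h2 h3 h4 h5] := hc s.
  rewrite h1 h2; congr (_, _); apply/ffunP => i; rewrite !ffunE.
  case: unliftP => [j ->|->]; first by rewrite h3 ffunE.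
  by have [_ _ -> _ _] := hc (target (c s)).1; rewrite ffunE h4.
rewrite inE card_imset // er eqxx andbT; apply/imsetP; exists [ffun s => c s] => //.
apply/setP => x; apply/imsetP/imsetP => [[v ve ->]|[s _ ->]].
  by have [s <-] := en_surj v ve; exists s.
by exists (en s).
Qed.
End Embedding.

Local Open Scope ring_scope.

(** * Elementary estimates *)

Section Averaging.
Variable R : realType.

Lemma exists_le_average (I : finType) (i0 : I) (F : I -> R) M :
  \sum_i F i <= #|I|%:R * M -> exists i, F i <= M.
Proof.
move=> h; apply/existsP; apply: contraTT h => /existsPn none.
rewrite -ltNge mulr_natl -sumr_const; apply: ltr_sum.
  by apply/hasP; exists i0; rewrite ?mem_index_enum.
by move=> i _; rewrite ltNge none.
Qed.

Lemma expR_le_linear (x : R) : 0 <= x <= 1/2 -> expR x <= 1 + 2 * x.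
Proof.
move=> /andP[x0 x1]; have x2 : 0 < 1 - x by lra.
have h : expR x * (1 - x) <= 1.
  have e : expR x * expR (- x) = 1 by rewrite -expRD subrr expR0.
  by rewrite -[leRHS]e ler_pM2l ?expR_gt0 // expR_ge1Dx.
by rewrite -(ler_pM2r x2) (le_trans h) //; nra.
Qed.

Lemma sum_half_pow (d k : nat) : \sum_(d <= j < k) 2^-1 ^+ j <= 2 * 2^-1 ^+ d :> R.
Proof.
have h j : 0 <= 2^-1 ^+ j :> R by rewrite exprn_ge0 // invr_ge0.
have [dk|kd] := leqP d k; last by rewrite big_geq ?mulr_ge0 // ltnW.
rewrite (@telescope_sumr_eq _ d k (fun j => - 2 * 2^-1 ^+ j)) //.
  by have := h k; lra.
by move=> j _; rewrite exprS; lra.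
Qed.

(** Linearising an exponential of a sum costs a constant factor in general.
    Here the tails decrease geometrically, and peeling off the terms in order
    shows that the j-th term is multiplied only by 1 + 2^-j / 4; the product of
    these factors over all j is bounded. *)
Lemma expR_sum_le (k : nat) (X : nat -> R) : (forall j, 0 <= X j) ->
  (forall d, \sum_(d <= j < k) X j <= 2^-1 ^+ d / 8) ->
  expR (\sum_(j < k) X j) <= 1 + \sum_(j < k) X j * (1 + 2^-1 ^+ j / 4).
Proof.
move=> X0 tail; rewrite -(big_mkord xpredT X).
rewrite -(big_mkord xpredT (fun j => X j * (1 + 2^-1 ^+ j / 4))).
suff : forall i d, (d + i)%N = k -> expR (\sum_(d <= j < k) X j) <=
    1 + \sum_(d <= j < k) X j * (1 + 2^-1 ^+ j / 4) by move=> /(_ k 0%N); apply.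
elim=> [|i IH] d dik.
  by rewrite -dik addn0 !big_geq // expR0 addr0.
have dk : (d < k)%N by rewrite -dik -addSnnS leq_addr.
have {}IH := IH d.+1 ltac:(by rewrite addSnnS).
have t := tail d; move: IH t; rewrite !(big_ltn dk).
set T := \sum_(_ <= _ < _) X _; set U := \sum_(_ <= _ < _) _ => IH t.
have T0 : 0 <= T by apply: sumr_ge0.
have p0 : 0 <= 2^-1 ^+ d :> R by rewrite exprn_ge0 // invr_ge0.
have p1 : 2^-1 ^+ d <= 1 :> R by rewrite exprn_ile1 ?invr_ge0 // invf_le1 // ler1n.
have Xd := X0 d.
have h1 : expR (X d + T) * (1 - X d) <= expR T.
  rewrite {2}(_ : T = (X d + T) + - X d); last by ring.
  by rewrite [X in _ <= X]expRD ler_pM2l ?expR_gt0 // expR_ge1Dx.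
have h2 : expR (X d + T) <= 1 + 2 * (X d + T) by apply: expR_le_linear; apply/andP; split; lra.
have h3 : X d * expR (X d + T) <= X d * (1 + 2^-1 ^+ d / 4) by apply: ler_wpM2l => //; lra.
by lra.
Qed.
Lemma sum_indicator (I : finType) (P : pred I) :
  \sum_i (P i)%:R = #|[set i | P i]|%:R :> R.
Proof.
rewrite -sum1_card natr_sum [RHS]big_mkcond /=; apply: eq_bigr => i _.
by rewrite inE; case: (P i).
Qed.

End Averaging.

(** * Equidistributed words on a forest *)

Section Forest.
Variables (R : realType) (A V L : finType) (a0 : A) (k' delta : nat).
Variables (par : V -> option V) (rk : V -> nat) (n : L -> V -> nat).
Hypothesis rkP : forall v y, par v = Some y -> (rk y < rk v)%N.
Hypothesis childrenP : forall y, (#|[set v | par v == Some y]| <= delta)%N.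
Hypothesis deltaP : (delta.*2 <= #|A|)%N.
Hypothesis nP : forall l v, (n l v <= 2)%N.

Let k := k'.+1.
Implicit Types (w : V -> k.-tuple A) (x z : k.-tuple A) (l : L) (S : {set V}).

(** Counts the descendants of [y] at distance exactly [d], weighted by [n l]. *)
Fixpoint descendants l d y : nat :=
  if d is d'.+1 then (\sum_(v | par v == Some y) descendants l d' v)%N else n l y.

Lemma descendants_bound l d y : (descendants l d y <= 2 * delta ^ d)%N.
Proof.
elim: d y => [|d IH] y /=; first by rewrite muln1.
apply: (@leq_trans (\sum_(v | par v == Some y) 2 * delta ^ d)%N).
  by apply: leq_sum => v _; apply: IH.
rewrite sum_nat_const mulnCA leq_mul2l /= expnS leq_mul2r; apply/orP; right.
by rewrite -cardsE; apply: childrenP.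
Qed.

Lemma sum_descendants l d :
  (\sum_v descendants l d v =
   \sum_(v | par v == None) descendants l d v + \sum_v descendants l d.+1 v)%N.
Proof.
rewrite (bigID (fun v => par v == None)) /=; congr addn.
rewrite (exchange_big_dep (fun v => par v != None)) /=; last by move=> y v _ /eqP ->.
apply: eq_bigr => v; case: (par v) => // y _.
by rewrite (big_pred1 y) // => z; rewrite eq_sym; apply/eqP/eqP => [[]|->].
Qed.

(** Going up from a node one either stops at a root within fewer than [d]
    steps or makes [d] steps. *)
Lemma sum_descendants_roots l d :
  (\sum_(v | par v == None) \sum_(j < d) descendants l j v + \sum_v descendants l d v
   = \sum_v n l v)%N.
Proof.
elim: d => [|d IH]; first by rewrite [X in (X + _)%N]big1 // => v _; rewrite big_ord0.
rewrite -IH [in RHS]sum_descendants addnA; congr addn.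
by rewrite -big_split; apply: eq_bigr => v _; rewrite big_ord_recr.
Qed.

Let q : R := #|A|%:R.
Let th : R := 64^-1.
(** Increases from 1 to 2 and absorbs the factors 1 + 2^-d / 4 of
    [expR_sum_le], one for each generation. *)
Definition rho (d : nat) : R := 2 - 2^-1 ^+ d.
(** A descendant of [v] at distance [d] gets the word x with probability q^-d
    if the word of [v] overlaps x with shift [d], and with probability 0
    otherwise.  So this is [th] times the expected number of such descendants,
    up to the factor [rho d]. *)
Definition overlap_weight l v d : R := th * rho d * q^-1 ^+ d * (descendants l d v)%:R.
(** The contribution of a child [v] to the weight with shift [d + 1] of its
    parent. *)
Definition child_weight l v d : R := th * rho d.+1 * q^-1 ^+ d.+1 * (descendants l d v)%:R.

Let half_ge0 d : 0 <= 2^-1 ^+ d :> R.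
Proof. by rewrite exprn_ge0 // invr_ge0. Qed.
Let half_le1 d : 2^-1 ^+ d <= 1 :> R.
Proof. by rewrite exprn_ile1 ?invr_ge0 // invf_le1 // ler1n. Qed.
Lemma rho_ge1 d : 1 <= rho d.
Proof. by rewrite /rho; have := half_le1 d; lra. Qed.
Lemma rho_le2 d : rho d <= 2.
Proof. by rewrite /rho; have := half_ge0 d; lra. Qed.
Let q_gt0 : 0 < q.
Proof. by rewrite ltr0n; apply/card_gt0P; exists a0. Qed.
Let qV_ge0 d : 0 <= q^-1 ^+ d.
Proof. by rewrite exprn_ge0 // invr_ge0 ltW. Qed.
Let th_ge0 : 0 <= th. Proof. by rewrite invr_ge0. Qed.

Lemma overlap_weight_ge0 l v d : 0 <= overlap_weight l v d.
Proof. by rewrite /overlap_weight !mulr_ge0 // (le_trans _ (rho_ge1 _)). Qed.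

(** With q at least twice the number of children, generation d contributes at
    most 4 [th] 2^-d; the value of [th] is chosen for this bound and
    [overlap_weight_child] to match. *)
Lemma overlap_weight_tail l v d : \sum_(d <= j < k) overlap_weight l v j <= 2^-1 ^+ d / 8.
Proof.
apply: (@le_trans _ _ (\sum_(d <= j < k) 16^-1 * 2^-1 ^+ j)); last first.
  by rewrite -mulr_sumr; have := sum_half_pow R d k; lra.
apply: ler_sum => j _.
have h1 : q^-1 ^+ j * (descendants l j v)%:R <= 2 * 2^-1 ^+ j.
  rewrite exprVn ler_pdivrMl ?exprn_gt0 // mulrCA -exprMn.
  apply: (@le_trans _ _ (2 * delta ^ j)%:R).
    by rewrite ler_nat descendants_bound.
  rewrite natrM natrX ler_pM2l //; apply: lerXn2r; rewrite ?nnegrE //.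
      by rewrite mulr_ge0 ?invr_ge0 // ltW.
    rewrite ler_pdivlMr // -natrM ler_nat muln2; exact: deltaP.
have h2 := rho_le2 j; have h3 := rho_ge1 j; rewrite /overlap_weight /th.
rewrite -!mulrA ler_pdivrMl //.
apply: (@le_trans _ _ (2 * (2 * 2^-1 ^+ j))); last by lra.
by apply: ler_pM => //; [lra | rewrite mulr_ge0].
Qed.

Lemma overlap_weight_child l v d :
  overlap_weight l v d * (1 + 2^-1 ^+ d / 4) <= q * child_weight l v d.
Proof.
rewrite /overlap_weight /child_weight exprS.
set N := _%:R; have N0 : 0 <= N by [].
have -> : q * (th * rho d.+1 * (q^-1 * q^-1 ^+ d) * N) = (th * q^-1 ^+ d * N) * rho d.+1.
  by field; rewrite gt_eqF.
have -> : th * rho d * q^-1 ^+ d * N * (1 + 2^-1 ^+ d / 4)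
  = (th * q^-1 ^+ d * N) * (rho d * (1 + 2^-1 ^+ d / 4)) by ring.
apply: ler_wpM2l; first by rewrite !mulr_ge0.
by rewrite /rho exprS; have := half_ge0 d; nra.
Qed.

(** The share of a node [v] outside [S] in a bound for the logarithm of the
    conditional expectation of exp ([th] times the number of occurrences of
    [x]), given the words of [S].  If the parent [y] has a known word, the node
    answers for the descendants whose words still overlap with it; the summand
    [child_weight l v k'] stands for those k - 1 generations below [v], whose
    words contain no letter above [v].  A root answers for all its
    descendants in less than k generations. *)
Definition reserve S w l x v : R :=
  if par v is Some y then
    child_weight l v k' +
    (if y \in S then \sum_(d < k') child_weight l v d * (overlap d.+1 (w y) x)%:R else 0)
  else \sum_(d < k) 2 * th * q^-1 ^+ k * (descendants l d v)%:R.

Definition potential S w l x : R :=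
  \sum_(v in S) th * (n l v)%:R * (w v == x)%:R + \sum_(v in ~: S) reserve S w l x v.

(** What the potential gains when the node [v] is given the word [z], before the
    reserve of [v] is released. *)
Definition gain l v z x : R := \sum_(d < k) overlap_weight l v d * (overlap d z x)%:R.

Definition assign (v : V) z w u := if u == v then z else w u.

Lemma gain_children l v z x :
  gain l v z x = th * (n l v)%:R * (z == x)%:R +
   \sum_(u | par u == Some v) \sum_(d < k') child_weight l u d * (overlap d.+1 z x)%:R.
Proof.
rewrite /gain big_ord_recl /= overlap0 /overlap_weight /rho expr0 !expr0 /=; congr (_ + _).
  by congr (_ * _); ring.
rewrite exchange_big /=; apply: eq_bigr => d _.
by rewrite -mulr_suml -mulr_sumr natr_sum.
Qed.

Lemma potential_assign S w l x c z : c \notin S ->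
  (forall v, v \in S -> par v != Some c) ->
  potential (c |: S) (assign c z w) l x
  = potential S w l x - reserve S w l x c + gain l c z x.
Proof.
move=> cS Sc; rewrite /potential gain_children.
have aS v : v \in S -> assign c z w v = w v.
  by rewrite /assign; case: eqP => // -> h; rewrite h in cS.
rewrite big_setU1 //= {1}/assign eqxx.
rewrite (eq_bigr (fun v => th * (n l v)%:R * (w v == x)%:R)); last first.
  by move=> v /aS ->.
rewrite [X in _ = _ + X - _ + _](bigD1 c) ?inE //=.
suff -> : \sum_(v in ~: (c |: S)) reserve (c |: S) (assign c z w) l x v =
   \sum_(i in ~: S | i != c) reserve S w l x i +
   \sum_(u | par u == Some c) \sum_(d < k') child_weight l u d * (overlap d.+1 z x)%:R by ring.
set F := fun u => \sum_(d < k') child_weight l u d * (overlap d.+1 z x)%:R.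
have -> : \sum_(u | par u == Some c) F u =
    \sum_(u in ~: (c |: S)) (if par u == Some c then F u else 0).
  rewrite -big_mkcondr; apply: eq_bigl => u; case: eqP => pu; last by rewrite andbF.
  rewrite andbT inE; apply/esym; rewrite !inE negb_or; apply/andP; split.
    by apply/eqP => uc; move: (rkP pu); rewrite uc ltnn.
  by apply/negP => /Sc; rewrite pu eqxx.
rewrite [X in _ = X + _](eq_bigl (fun v => v \in ~: (c |: S))); last first.
  by move=> v; rewrite !inE negb_or andbC.
rewrite -big_split /=; apply: eq_bigr => v; rewrite !inE negb_or => /andP [vc vS].
rewrite /reserve; case E: (par v) => [y|]; last by rewrite addr0.
have [->|yc] := eqVneq y c.
  rewrite eqxx (negPf cS) !inE eqxx /= addr0; congr (_ + _).
  by rewrite /assign eqxx.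
have -> : (Some y == Some c) = false by apply/eqP => -[]; apply/eqP.
by rewrite !inE (negPf yc) /= addr0 /assign (negPf yc).
Qed.

Lemma gain_le l v z x :
  expR (gain l v z x) <= 1 + \sum_(d < k) q * child_weight l v d * (overlap d z x)%:R.
Proof.
apply: le_trans (_ : 1 +
  \sum_(d < k) overlap_weight l v d * (overlap d z x)%:R * (1 + 2^-1 ^+ d / 4) <= _).
  apply: (@expR_sum_le _ _ (fun d => overlap_weight l v d * (overlap d z x)%:R)).
    by move=> j; rewrite mulr_ge0 // overlap_weight_ge0.
  move=> d; apply: le_trans (overlap_weight_tail l v d); apply: ler_sum => j _.
  by rewrite ler_piMr ?overlap_weight_ge0 // lern1 leq_b1.
rewrite lerD2l; apply: ler_sum => d _; rewrite mulrAC.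
by apply: ler_wpM2r => //; apply: overlap_weight_child.
Qed.

Lemma child_weight_ge0 l v d : 0 <= child_weight l v d.
Proof. by rewrite /child_weight !mulr_ge0 // (le_trans _ (rho_ge1 _)). Qed.

(** Averaging over the letter of [v], the expected gain is covered by the reserve. *)
Lemma gain_average_child S w l x v y : par v = Some y -> y \in S ->
  \sum_a expR (gain l v (push a (w y)) x) <= #|A|%:R * expR (reserve S w l x v).
Proof.
move=> pv yS; apply: le_trans (ler_sum _ (fun a _ => gain_le l v (push a (w y)) x)) _.
rewrite big_split /= sumr_const exchange_big /= -/q.
apply: le_trans (_ : q * (1 + reserve S w l x v) <= _); last first.
  by rewrite ler_pM2l // expR_ge1Dx.
have -> : reserve S w l x v = \sum_(d < k) child_weight l v d * (overlap d.+1 (w y) x)%:R.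
  by rewrite big_ord_recr /= overlap_full mulr1 /reserve pv yS addrC.
rewrite mulrDr mulr1 lerD2l.
rewrite mulr_sumr; apply: ler_sum => d _; rewrite -mulr_sumr -mulrA.
rewrite ler_pM2l //; apply: ler_wpM2l; first exact: child_weight_ge0.
by rewrite sum_indicator ler_nat count_overlap_push.
Qed.

(** A root has a uniformly random word, so it overlaps [x] with shift d with probability q^(d-k). *)
Lemma gain_average_root S w l x v : par v = None ->
  \sum_z expR (gain l v z x) <= #|{: k.-tuple A}|%:R * expR (reserve S w l x v).
Proof.
move=> pv; apply: le_trans (ler_sum _ (fun z _ => gain_le l v z x)) _.
rewrite big_split /= sumr_const exchange_big /=.
apply: le_trans (_ : #|{: k.-tuple A}|%:R * (1 + reserve S w l x v) <= _); last first.
  by rewrite ler_wpM2l // expR_ge1Dx.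
rewrite mulrDr mulr1 lerD2l /reserve pv card_tuple natrX -/q.
rewrite mulr_sumr; apply: ler_sum => d _; rewrite -mulr_sumr sum_indicator.
apply: le_trans (_ : q * child_weight l v d * q ^+ d <= _).
  apply: ler_wpM2l; first by rewrite mulr_ge0 ?child_weight_ge0 // ltW.
  by rewrite -natrX ler_nat count_overlap // ltnW.
rewrite /child_weight.
have -> : q * (th * rho d.+1 * q^-1 ^+ d.+1 * (descendants l d v)%:R) * q ^+ d
    = th * (descendants l d v)%:R * rho d.+1.
  rewrite exprVn exprS; field; have q0 : q != 0 by rewrite gt_eqF. rewrite ?expf_neq0 ?q0 //.
have -> : q ^+ k * (2 * th * q^-1 ^+ k * (descendants l d v)%:R) = th * (descendants l d v)%:R * 2.
  rewrite exprVn; field; have q0 : q != 0 by rewrite gt_eqF. rewrite ?expf_neq0 ?q0 //.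
by apply: ler_wpM2l; rewrite ?rho_le2 // mulr_ge0.
Qed.

Definition consistent S w :=
  forall v y, v \in S -> par v = Some y -> exists a, w v = push a (w y).

Definition total_potential S w := \sum_l \sum_x expR (potential S w l x).

Lemma total_potential_assign S w c (I : finType) (i0 : I) (f : I -> k.-tuple A) :
  c \notin S -> (forall v, v \in S -> par v != Some c) ->
  (forall l x, \sum_i expR (gain l c (f i) x) <= #|I|%:R * expR (reserve S w l x c)) ->
  exists i, total_potential (c |: S) (assign c (f i) w) <= total_potential S w.
Proof.
move=> cS Sc h; apply: exists_le_average => //.
rewrite exchange_big mulr_sumr; apply: ler_sum => l _.
rewrite exchange_big mulr_sumr; apply: ler_sum => x _.
under eq_bigr do rewrite potential_assign // expRD.
rewrite -mulr_sumr expRB -mulrA [leRHS]mulrC ler_pM2l ?expR_gt0 //.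
by rewrite ler_pdivrMl ?expR_gt0 // mulrC.
Qed.

(** The words are fixed one node at a time, parents first, and each time some
    choice does not exceed the average. *)
Lemma forest_assignment_potential w0 : exists w, consistent [set: V] w /\
  total_potential [set: V] w <= total_potential set0 w0.
Proof.
suff ind m S w : (#|~: S| <= m)%N ->
    (forall v y, v \in S -> par v = Some y -> y \in S) -> consistent S w ->
    exists w', consistent [set: V] w' /\ total_potential [set: V] w' <= total_potential S w.
  by have [||w' h] := ind _ set0 w0 (leqnn _); [move=> v y; rewrite inE..|exists w'].
elim: m S w => [|m IH] S w.
  rewrite leqn0 cards_eq0 => /eqP S0 _ cw; exists w.
  by have -> : [set: V] = S by rewrite -[S]setCK S0 setC0.
move=> Sm Sd cw; have [S0|[c0 c0S]] := set_0Vmem (~: S).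
  exists w; by have -> : [set: V] = S by rewrite -[S]setCK S0 setC0.
(* a node of minimal rank outside [S] has its parent in [S] *)
have [c cS cmin] := @arg_minnP _ c0 (fun v => v \in ~: S) rk c0S.
have cS' : c \notin S by rewrite -in_setC.
have parS y : par c = Some y -> y \in S.
  move=> pc; apply: contraTT (rkP pc) => yS; rewrite -leqNgt.
  by apply: cmin; rewrite in_setC.
have Sc v : v \in S -> par v != Some c.
  by move=> vS; apply: contra cS' => /eqP; apply: Sd vS.
have [z pz zc] : exists2 z, (forall y, par c = Some y -> exists a, z = push a (w y)) &
    total_potential (c |: S) (assign c z w) <= total_potential S w.
  case E: (par c) => [y|].
    have yS := parS y E.
    have [a ha] := @total_potential_assign S w c A a0 (fun a => push a (w y)) cS' Sc
      (fun l x => gain_average_child w l x E yS).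
    by exists (push a (w y)) => // y' [<-]; exists a.
  have [z hz] := @total_potential_assign S w c _ (w c) id cS' Sc
      (fun l x => gain_average_root S w l x E).
  by exists z.
have [|||w' [cw' hw']] := IH (c |: S) (assign c z w).
- rewrite -ltnS (leq_trans _ Sm) // [X in (_ < X)%N](cardsD1 c) inE cS' add1n ltnS.
  by apply: subset_leq_card; apply/subsetP => v; rewrite !inE negb_or.
- move=> v y; rewrite !inE => /orP [/eqP ->|vS] pv; first by rewrite parS ?orbT.
  by rewrite (Sd _ _ vS pv) orbT.
- move=> v y; rewrite !inE => vcS pv.
  have yc : y \in S by case/orP: vcS => [/eqP vc|vS]; [apply: parS; rewrite -vc | apply: Sd vS pv].
  have ycN : y != c by apply: contraNneq cS' => <-.
  rewrite /assign (negPf ycN); have [vc|vc] := eqVneq v c; first by apply: pz; rewrite -vc.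
  by rewrite (negPf vc) /= in vcS; apply: cw.
by exists w'; split => //; apply: le_trans hw' zc.
Qed.

Lemma potential_set0_le w l x :
  potential set0 w l x <= 2 * th * q^-1 ^+ k * (\sum_v n l v)%:R.
Proof.
rewrite /potential big_set0 add0r.
apply: le_trans (_ : 2 * th * q^-1 ^+ k *
  (\sum_(v | par v == None) \sum_(j < k) descendants l j v +
   \sum_(v | par v != None) descendants l k' v)%:R <= _); last first.
  rewrite ler_wpM2l ?mulr_ge0 // ler_nat -(sum_descendants_roots l k').
  under eq_bigr do rewrite big_ord_recr.
  rewrite big_split /= -addnA leq_add2l.
  by rewrite [X in (_ <= X)%N](bigID (fun v => par v == None)).
rewrite natrD mulrDr !natr_sum !mulr_sumr.
rewrite (bigID (fun v => par v == None)) /=; apply: lerD.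
  rewrite (eq_bigl (fun v => par v == None)); last by move=> v; rewrite !inE.
  apply: ler_sum => v /eqP pv; rewrite /reserve pv natr_sum mulr_sumr.
  exact: lexx.
rewrite (eq_bigl (fun v => par v != None)); last by move=> v; rewrite !inE.
apply: ler_sum => v; rewrite /reserve; case: (par v) => // y _.
rewrite inE addr0 /child_weight; apply: ler_wpM2r => //; apply: ler_wpM2r => //.
by rewrite [2 * th]mulrC; apply: ler_wpM2l => //; apply: rho_le2.
Qed.

(** The initial potential is small because every node is counted only once: by
    the root above it, or by its ancestor k - 1 generations up.  The final
    potential is an upper bound for each of its terms, that is, for each
    single fibre. *)
Lemma forest_words : exists w,
  (forall v y, par v = Some y -> exists a, w v = push a (w y)) /\
  forall l x, expR (th * (\sum_(v | w v == x) n l v)%:R)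
    <= \sum_(l' : L) #|A|%:R ^+ k * expR (2 * th * (\sum_v n l' v)%:R / #|A|%:R ^+ k).
Proof.
have [w [cw pw]] := forest_assignment_potential (fun=> [tuple of nseq k a0]).
exists w; split=> [v y pv|l x]; first by apply: cw pv; rewrite inE.
apply: le_trans (_ : total_potential [set: V] w <= _).
  rewrite /total_potential (bigD1 l) //= (bigD1 x) //= -addrA.
  apply: le_trans (_ : expR (potential [set: V] w l x) <= _); last first.
    by rewrite lerDl addr_ge0 //; do ?[apply: sumr_ge0 => ? _]; apply: expR_ge0.
  rewrite ler_expR /potential setCT big_set0 addr0 natr_sum mulr_sumr.
  rewrite big_mkcond /= [X in _ <= X](eq_bigl xpredT); last by move=> v; rewrite inE.
  by apply: ler_sum => v _; case: (w v == x); rewrite ?mulr1 ?mulr0.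
apply: le_trans pw _; apply: ler_sum => l' _.
apply: (@le_trans _ _ (\sum_(x : k.-tuple A) expR (2 * th * (\sum_v n l' v)%:R / #|A|%:R ^+ k))).
  apply: ler_sum => x' _.
  by rewrite ler_expR (le_trans (potential_set0_le _ _ _)) // exprVn mulrAC.
by rewrite sumr_const card_tuple -[leLHS]mulr_natl natrX.
Qed.

End Forest.

(** * Positions with small fibres *)

Section Balanced.
Variables (R : realType) (A V : finType) (a0 : A) (k' d : nat).
Hypothesis d_gt0 : (0 < d)%N.
Hypothesis dP : (d.*2.+1.*2 <= #|A|)%N.
Let m : nat := (#|A| ^ k'.+1)%N.

Let A_gt0 : (0 < #|A|)%N. Proof. by apply/card_gt0P; exists a0. Qed.
Let m_gt0 : (0 < m)%N. Proof. by rewrite expn_gt0 A_gt0. Qed.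

(** Taking logarithms in [forest_words] for the folded forest.  A node stands
    for at most two vertices, and it has at most 2 d + 1 children. *)
Lemma balanced_words (g : V -> V) (L : finType) (lab : V -> L) (N : R) :
  (forall u, #|[set v | g v == u]| <= d)%N ->
  (forall l, #|[set v | lab v == l]|%:R <= N) ->
  exists f : V -> k'.+1.-tuple A,
    (forall v, exists c, f v = decode c (f (g v))) /\
    (forall l x, #|[set v | (lab v == l) && (f v == x)]|%:R
        <= 64 * ln (#|L| * m)%:R + 2 * N / m%:R).
Proof.
move=> gd labN.
pose n l y := #|[set v | (lab v == l) && (fold g v == y)]|.
have n2 l y : (n l y <= 2)%N.
  apply: leq_trans (fold_fibre g y); apply: subset_leq_card.
  by apply/subsetP => v; rewrite !inE => /andP[].
have nsum (P : pred V) l :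
    (\sum_(y | P y) n l y = #|[set v | (lab v == l) && P (fold g v)]|)%N.
  rewrite -[RHS]sum1_card [RHS](partition_big (fold g) P) /=; last first.
    by move=> v; rewrite inE => /andP[].
  apply: eq_bigr => y Py; rewrite /n -sum1_card; apply: eq_bigl => v.
  by rewrite !inE -andbA; case: (fold g v =P y) => [->|_]; rewrite ?andbF // Py.
have [w [wpar wexp]] := forest_words R a0 k' (fold_parent_rank (g := g))
  (fun y => fold_children y gd) dP n2.
exists (fun v => w (fold g v)); split=> [v|l x].
  have [->|/wpar [a ->]|/wpar [a E]] := fold_adjacent g v; first by exists None.
    by exists (Some (true, a)).
  by have [b hb] := push_pull a (w (fold g v)); exists (Some (false, b)); rewrite /= E.
have := wexp l x; rewrite nsum => h.
have L0 : (0 < #|L|)%N by apply/card_gt0P; exists l.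
have Lm0 : 0 < (#|L| * m)%:R :> R by rewrite ltr0n muln_gt0 L0.
have m0 : 0 < m%:R :> R by rewrite ltr0n.
suff : 64^-1 * #|[set v | (lab v == l) && (w (fold g v) == x)]|%:R
   <= ln (#|L| * m)%:R + 2 * 64^-1 * N / m%:R :> R by lra.
rewrite -ler_expR expRD lnK ?posrE //; apply: (le_trans h).
rewrite natrM -mulrA -natrX -/m.
apply: (@le_trans _ _ (\sum_(l' : L) m%:R * expR (2 * 64^-1 * N / m%:R))).
  apply: ler_sum => l' _; apply: ler_wpM2l => //.
  rewrite ler_expR; apply: ler_wpM2r; first by rewrite invr_ge0.
  apply: ler_wpM2l; first by rewrite mulr_ge0 ?invr_ge0.
  have /= -> := nsum xpredT l'.
  apply: le_trans (labN l'); rewrite ler_nat; apply: subset_leq_card.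
  by apply/subsetP => v; rewrite !inE andbT.
by rewrite sumr_const -[leLHS]mulr_natl.
Qed.

(** The classes of stage j are the fibres of the first j colours.  From one
    stage to the next, a bound 128 [lam] + 2^j |V| / m^j turns into
    64 [lam] + 2 (128 [lam]) / m + 2^(j+1) |V| / m^(j+1), and m is at least 4. *)
Lemma balanced_positions (D : nat) (g : 'I_D -> V -> V) :
  (forall i u, #|[set v | g i v == u]| <= d)%N ->
  exists f : 'I_D -> V -> k'.+1.-tuple A,
    (forall i v, exists c, f i v = decode c (f i (g i v))) /\
    (forall x, #|[set v | [ffun i => f i v] == x]|%:R
       <= 128 * ln (m ^ D)%:R + 2 ^+ D * #|V|%:R / (m ^ D)%:R :> R).
Proof.
move=> gd; pose g' i := if insub i is Some i' then g i' else id.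
have g'E (i : 'I_D) : g' i = g i by rewrite /g' valK.
have m4 : 4 <= m%:R :> R.
  rewrite ler_nat; apply: (@leq_trans #|A|); last first.
    by rewrite -[X in (X <= _)%N]expn1 leq_pexp2l.
  by apply: leq_trans dP; move: d_gt0; case: (d) => // e _; rewrite !doubleS.
have m0 : 0 < m%:R :> R by apply: lt_le_trans m4.
have mX j : (0 < m ^ j)%N by rewrite expn_gt0 m_gt0.
have ln_ge j : (j <= D)%N -> ln (m ^ j)%:R <= ln (m ^ D)%:R :> R.
  move=> jD; rewrite ler_ln ?posrE ?ltr0n ?mX //.
  by rewrite ler_nat leq_pexp2l.
pose lam : R := ln (m ^ D)%:R.
have lam0 : 0 <= lam by rewrite ln_ge0 // ler1n mX.
suff : forall j, (j <= D)%N -> exists f : nat -> V -> k'.+1.-tuple A,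
    (forall i, (i < j)%N -> forall v, exists c, f i v = decode c (f i (g' i v))) /\
    (forall x, #|[set v | [ffun i : 'I_j => f i v] == x]|%:R
       <= 128 * lam + 2 ^+ j * #|V|%:R / (m ^ j)%:R).
  move=> /(_ D (leqnn D)) [f [f1 f2]]; exists (fun i : 'I_D => f i); split=> // i v.
  by have := f1 i (ltn_ord i) v; rewrite g'E.
elim=> [_|j IH jD].
  exists (fun _ _ => [tuple of nseq _ a0]); split=> // x.
  rewrite expr0 mul1r expn0 divr1; apply: (@le_trans _ _ #|V|%:R).
    by rewrite ler_nat max_card.
  by rewrite lerDr mulr_ge0.
have [f [f1 f2]] := IH (ltnW jD).
have g'd u : (#|[set v | g' j v == u]| <= d)%N.
  by have := gd (Ordinal jD) u; rewrite -g'E.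
have [w [w1 w2]] := balanced_words (lab := fun v => [ffun i : 'I_j => f i v]) g'd f2.
exists (fun i => if i == j then w else f i); split=> [i|x].
  by rewrite ltnS leq_eqVlt => /predU1P [->|ij] v; [rewrite eqxx | rewrite ltn_eqF //; apply: f1].
apply: le_trans (_ : _ <= 64 * ln (#|{ffun 'I_j -> k'.+1.-tuple A}| * m)%:R + 2 *
   (128 * lam + 2 ^+ j * #|V|%:R / (m ^ j)%:R) / m%:R) _.
  apply: le_trans (w2 [ffun i => x (widen_ord (leqnSn j) i)] (x ord_max)).
  rewrite ler_nat; apply: subset_leq_card; apply/subsetP => v; rewrite !inE => /eqP <-.
  rewrite ffunE eqxx eqxx andbT; apply/eqP/ffunP => i; rewrite !ffunE /=.
  by rewrite ltn_eqF.
have -> : (#|{ffun 'I_j -> k'.+1.-tuple A}| * m = m ^ j.+1)%N.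
  by rewrite card_ffun card_ord card_tuple -/m [RHS]expnSr.
have h := ln_ge _ jD; rewrite -/lam in h.
have h2 : 2 * (128 * lam) / m%:R <= 64 * lam.
  by rewrite ler_pdivrMr //; nra.
rewrite [2 * (_ + _)]mulrDr [(_ + _) / m%:R]mulrDl.
have -> : 2 * (2 ^+ j * #|V|%:R / (m ^ j)%:R) / m%:R = 2 ^+ j.+1 * #|V|%:R / (m ^ j.+1)%:R :> R.
  rewrite exprS expnSr natrM; field; rewrite gt_eqF //= pnatr_eq0.
  by rewrite -lt0n mX.
by lra.
Qed.
End Balanced.

Lemma host_universal (R : realType) (r D' K k' n : nat) (A : finType) :
  (1 < r)%N -> (0 < D')%N ->
  ((D'.+1 * r).+1.*2.+1.*2 <= #|A|)%N ->
  let M := ((#|A| ^ k'.+1) ^ D'.+1)%N in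
  128 * ln M%:R + 2 ^+ D'.+1 * n%:R / M%:R <= K%:R :> R ->
  universal (bounded_degree_family D'.+1 n) (host r D' K k'.+1 A).
Proof.
move=> r1 D0 hA M hK H [Hn HD].
have degE v : (#|[set e in hedges H | v \in e]| <= D'.+1)%N.
  by apply: leq_trans HD; rewrite /max_degree (leq_bigmax (F := @degree r H)).
have E2 e : e \in hedges H -> (1 < #|e|)%N by move=> /hedges_uniform ->.
have [col colP ncol] := incidence_colouring (D0 : (1 < D'.+1)%N) E2 degE.
have a0 : A by apply: (@enum_val _ A (Ordinal (leq_trans (ltn0Sn _) hA))).
have [f [f1 f2]] := balanced_positions R a0 k' (ltn0Sn _) hA
  (fun i u => walk_preimages col i u (@hedges_uniform r H) degE).
apply: (embedding (col := col) (g := walk (hedges H) col) (f := f)) => //.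
- by move=> e v eE ve; apply: walkP => //; apply: ncol.
- by move=> x; rewrite -(ler_nat R); apply: le_trans (f2 x) _; rewrite Hn.
Qed.

(** * Choice of the parameters and the edge count *)

Section ParameterChoice.
Variables (R : realType) (q D n : nat).
Hypotheses (q1 : (1 < q)%N) (D0 : (0 < D)%N) (n1 : (1 < n)%N).
Let L : R := ln n%:R.

Lemma ln_nat_gt0 : 0 < L.
Proof. by rewrite ln_gt0 // ltr1n. Qed.

Lemma ln_nat_ge_ln2 : ln 2 <= L.
Proof. by rewrite ler_ln ?posrE ?ltr0n ?ler_nat // ltnW. Qed.

(** The least k with n <= (q^k)^D ln n; minimality gives the upper bound, up to
    the factor q^D of one more letter. *)
Lemma exists_word_length :
  exists k', n%:R <= ((q ^ k'.+1) ^ D)%:R * L /\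
             ((q ^ k'.+1) ^ D)%:R * L <= (q ^ D)%:R * n%:R.
Proof.
have L0 := ln_nat_gt0.
have ex : exists k, n%:R <= ((q ^ k) ^ D)%:R * L.
  have h0 : 0 <= n%:R / L by rewrite divr_ge0 // ltW.
  exists (Num.truncn (n%:R / L)).+1; rewrite -ler_pdivrMr //.
  apply: ltW (lt_le_trans (truncnS_gt _) _).
  rewrite ler_nat; set t := _.+1.
  apply: leq_trans (ltnW (ltn_expl t q1)) _.
  by rewrite -[X in (X <= _)%N]expn1 leq_pexp2l // expn_gt0 ltnW.
case: (ex_minnP ex) => -[|k'] hk hmin.
  move: hk; rewrite expn0 exp1n mul1r leNgt ln_sublinear // ltr0n; exact: ltnW.
exists k'; split=> //; apply: ltW.
rewrite expnS expnMn natrM -mulrA ltr_pM2l ?ltr0n ?expn_gt0 ?(ltnW q1) //.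
by rewrite ltNge; apply/negP => /hmin; rewrite ltnn.
Qed.

Lemma exists_copies (M : nat) : n%:R <= M%:R * L -> M%:R * L <= (q ^ D)%:R * n%:R ->
  exists K : nat, 128 * ln M%:R + 2 ^+ D * n%:R / M%:R <= K%:R :> R /\
    K%:R <= (128 * (`|ln ((q ^ D)%:R / ln 2)| / ln 2 + 1) + 2 ^+ D + (ln 2)^-1) * L.
Proof.
move=> h1 h2; have L0 := ln_nat_gt0; have L2 := ln_nat_ge_ln2.
have n0 : 0 < n%:R :> R by rewrite ltr0n ltnW.
have l2 : 0 < ln 2 :> R by rewrite ln_gt0 // ltr1n.
have M0 : 0 < M%:R :> R.
  by rewrite -(pmulr_lgt0 _ L0); apply: lt_le_trans h1.
have qD0 : 0 < (q ^ D)%:R :> R by rewrite ltr0n expn_gt0 ltnW.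
set C2 : R := ln ((q ^ D)%:R / ln 2).
have onele : 1 <= (ln 2)^-1 * L by rewrite mulrC ler_pdivlMr // mul1r.
have lnM : ln M%:R <= (`|C2| / ln 2 + 1) * L.
  apply: (@le_trans _ _ (C2 + L)).
    rewrite -lnM ?posrE ?divr_gt0 // ler_ln ?posrE ?mulr_gt0 ?divr_gt0 ?invr_gt0 //.
    rewrite mulrAC ler_pdivlMr //; apply: le_trans h2; exact: ler_wpM2l (ltW M0) _ _ L2.
  rewrite mulrDl mul1r lerD2r -mulrA; apply: le_trans (ler_norm _) _.
  by rewrite ler_peMr.
have nM : 2 ^+ D * n%:R / M%:R <= 2 ^+ D * L.
  by rewrite -mulrA ler_pM2l ?exprn_gt0 // ler_pdivrMr // mulrC.
set B : R := _ + _.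
have B0 : 0 <= B.
  apply: addr_ge0; last by rewrite divr_ge0 ?mulr_ge0 ?exprn_ge0.
  by rewrite mulr_ge0 // ln_ge0 // ler1n -(ltr0n R).
exists (Num.truncn B).+1; split; first by apply: ltW; apply: truncnS_gt.
have hB : (Num.truncn B)%:R <= B by rewrite truncn_le.
rewrite -natr1.
have hB' : B <= 128 * ((`|C2| / ln 2 + 1) * L) + 2 ^+ D * L.
  by apply: lerD => //; rewrite ler_pM2l.
apply: le_trans (lerD (le_trans hB hB') onele) _.
by rewrite [leRHS]mulrDl [X in _ <= X + _]mulrDl mulrA.
Qed.
End ParameterChoice.

(** With a and b the (D'+1)-th roots of n and L, the bound on x^(D'+1) L reads
    x b <= q a, and then x^D' L = (x b)^D' b <= (q a)^D' b. *)
Lemma edge_bound (R : realType) (r D' : nat) (x q n L K C1 : R) :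
  0 <= x -> 0 <= q -> 0 <= n -> 0 <= L -> 0 <= K -> 0 <= C1 ->
  x ^+ D'.+1 * L <= q ^+ D'.+1 * n -> K <= C1 * L ->
  (x ^+ D' * K) ^+ r <=
    (C1 * q ^+ D') ^+ r * (n `^ (r%:R - r%:R / D'.+1%:R) * L `^ (r%:R / D'.+1%:R)).
Proof.
move=> x0 q0 n0 L0 K0 C0 hx hK.
pose a := n `^ D'.+1%:R^-1; pose b := L `^ D'.+1%:R^-1.
have a0 : 0 <= a by apply: powR_ge0.
have b0 : 0 <= b by apply: powR_ge0.
have Dn0 : D'.+1%:R != 0 :> R by rewrite pnatr_eq0.
have aD : a ^+ D'.+1 = n by rewrite -powR_mulrn // -powRrM mulVf // powRr1.
have bD : b ^+ D'.+1 = L by rewrite -powR_mulrn // -powRrM mulVf // powRr1.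
have xb : x * b <= q * a.
  by rewrite -(@ler_pXn2r _ D'.+1) ?nnegrE ?mulr_ge0 // !exprMn aD bD.
have -> : n `^ (r%:R - r%:R / D'.+1%:R) = (a ^+ D') ^+ r.
  rewrite -exprM -powR_mulrn // -powRrM; congr (_ `^ _).
  by rewrite natrM -natr1; field; rewrite natr1.
have -> : L `^ (r%:R / D'.+1%:R) = b ^+ r.
  by rewrite -powR_mulrn // -powRrM mulrC.
rewrite -!exprMn; apply: lerXn2r; rewrite ?nnegrE ?mulr_ge0 ?exprn_ge0 //.
apply: (@le_trans _ _ (x ^+ D' * (C1 * L))); first by rewrite ler_wpM2l ?exprn_ge0.
rewrite -bD exprSr.
have -> : x ^+ D' * (C1 * (b ^+ D' * b)) = C1 * b * (x * b) ^+ D' by rewrite exprMn; ring.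
have -> : C1 * q ^+ D' * (a ^+ D' * b) = C1 * b * (q * a) ^+ D' by rewrite exprMn; ring.
by apply: ler_wpM2l; rewrite ?mulr_ge0 // lerXn2r // ?nnegrE mulr_ge0.
Qed.

Lemma set0_uniform (r : nat) (V : finType) (e : {set V}) :
  e \in (set0 : {set {set V}}) -> #|e| = r.
Proof. by rewrite inE. Qed.

(** The host for n <= 1, where ln n vanishes and so does the bound. *)
Definition edgeless (r : nat) (V : finType) : hypergraph r :=
  Hypergraph (@set0_uniform r V).

Lemma edgeless_universal (r D n : nat) : (1 < r)%N -> (n <= 1)%N ->
  universal (bounded_degree_family D n) (edgeless r 'I_n).
Proof.
move=> r1 n1 H [Hn _].
exists (fun v => cast_ord Hn (enum_rank v)); split.
  by move=> u v /cast_ord_inj /enum_rank_inj.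
move=> e /hedges_uniform er.
have : (r <= n)%N by rewrite -[X in (X <= _)%N]er -[X in (_ <= X)%N]Hn max_card.
by rewrite leqNgt (leq_ltn_trans n1 r1).
Qed.

Theorem theorem1p1 (R : realType) (r D : nat) (hr : (2 <= r)%N) (hD : (2 <= D)%N) :
  exists C : R, 0 < C /\
    forall n : nat, exists G : hypergraph r,
      (#|hedges G|%:R <= C * n%:R `^ (r%:R - r%:R / D%:R)
                           * (ln n%:R) `^ (r%:R / D%:R)) /\
      universal (bounded_degree_family D n) G.
Proof.
case: D hD => [//|D']; rewrite ltnS => D'0.
pose q := (D'.+1 * r).+1.*2.+1.*2.
have q1 : (1 < q)%N by rewrite /q !doubleS.
have l2 : 0 < ln 2 :> R by rewrite ln_gt0 // ltr1n.
pose C1 : R := 128 * (`|ln ((q ^ D'.+1)%:R / ln 2)| / ln 2 + 1) + 2 ^+ D'.+1 + (ln 2)^-1.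
have C10 : 0 < C1.
  rewrite ltr_wpDl ?invr_gt0 // addr_ge0 ?exprn_ge0 // mulr_ge0 // addr_ge0 //.
  by rewrite divr_ge0 // ltW.
pose C3 : nat := (D'.+1 * (r * D') * (2 * q).+1)%N.
have C30 : 0 < C3%:R :> R by rewrite ltr0n !muln_gt0 /= D'0 (ltnW hr).
exists (C3%:R ^+ r * (C1 * q%:R ^+ D') ^+ r); split.
  by rewrite mulr_gt0 ?exprn_gt0 // mulr_gt0 // exprn_gt0 // ltr0n ltnW.
move=> n; have [n1|n1] := leqP n 1.
  exists (edgeless r 'I_n); split; last exact: edgeless_universal.
  rewrite cards0 !mulr_ge0 ?powR_ge0 ?exprn_ge0 // ?mulr_ge0 ?exprn_ge0 //; exact: ltW.
have [k' [k1 k2]] := exists_word_length R q1 (isT : (0 < D'.+1)%N) n1.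
have [K [K1 K2]] := exists_copies q1 n1 k1 k2.
exists (host r D' K k'.+1 'I_q); split; last first.
  by apply: (@host_universal R); rewrite ?card_ord.
have := card_host_edges r D' K k'.+1 'I_q; rewrite card_ord -/C3.
rewrite -(ler_nat R) => h; apply: le_trans h _.
rewrite -mulnA natrX natrM exprMn natrM natrX -!mulrA ler_pM2l ?exprn_gt0 //.
apply: edge_bound => //; rewrite -/C1 //; try exact: ltW.
  by rewrite ltW // ln_nat_gt0.
by rewrite -!natrX.
Qed.
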